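(* Consider the planar system $$\dot x=-x-y,\qquad \dot y=px+ry-sy^2-y^3$$ and its equilibrium $P_2=(x_2^*,-x_2^* )$, where $x_2^*=\tfrac12\big(s-\sqrt{s^2+4(r-p)}\big)$. The equilibrium $P_2$ undergoes a subcritical Hopf bifurcation when $$s\ge0,\qquad p>1,\qquad r=\tfrac18\Big(-4+12p-s^2+s\sqrt{-8+8p+s^2}\Big).$$
   Context: The parameters $p,r$ are positive reals and $s\ge 0$; $r$ is the bifurcation parameter. A Hopf bifurcation at an equilibrium means that the Jacobian has a pair of purely imaginary eigenvalues $\pm i\omega$, $\omega>0$, at the critical parameter value, crossing the imaginary axis transversally as the parameter varies. It is subcritical if the first Lyapunov coefficient $l_1$ at the equilibrium is positive (the bifurcating limit cycle is unstable). Here $l_1=\frac1{2\omega^2}\operatorname{Re}(ig_{20}g_{11}+\omega g_{21})$, where, after translating the equilibrium to the origin and writing the state as $z\mathbf q+\bar z\bar{\mathbf q}$ with $\mathbf q$ an eigenvector for $i\omega$, the system takes the form $\dot z=i\omega z+\sum_{j+k\ge2}\frac{1}{j!k!}g_{jk}z^j\bar z^k$ (the sign of $l_1$ does not depend on the choice of $\mathbf q$). *)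

(* Defs.v *)
From HB Require Import structures.
From mathcomp Require Import all_boot all_order all_algebra.
From mathcomp Require Import complex.
From mathcomp Require Import all_classical all_reals all_analysis.
Set Implicit Arguments.
Unset Strict Implicit.
Unset Printing Implicit Defensive.
Import Order.TTheory GRing.Theory Num.Theory.
Import numFieldNormedType.Exports.
Local Open Scope classical_set_scope.
Local Open Scope ring_scope.
Local Open Scope complex_scope.

(* The state space is 'rV[R]_2. MathComp's [jacobian] acts on row vectors from
   the right ('d f x v = v *m jacobian f x), so it is the transpose of the usual
   Jacobian matrix, and the usual eigenvector equation A q = a q reads
   q *m J = a *: q, in agreement with [eigenvalue]. *)

Definition vec2 (K : Type) (a b : K) : 'rV[K]_2 :=
  \row_(j < 2) if j == 0 then a else b.

Definition cplx_mx (R : realType) (m n : nat) (A : 'M[R]_(m, n)) :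
    'M[R[i]]_(m, n) :=
  map_mx (real_complex R) A.

Definition cplx_jacobian (R : realType) (f : 'rV[R]_2 -> 'rV[R]_2)
    (x : 'rV[R]_2) : 'M[R[i]]_2 :=
  cplx_mx (jacobian f x).

(* [E r] is an equilibrium of the system x' = f r x for r close to r0. The last
   clause is transversality: the eigenvalue of the linearization at [E r] that
   continues i omega crosses the imaginary axis with nonzero speed. The
   conjugate of [lambda r] is then an eigenvalue too, the Jacobian being real. *)
Definition hopf_point (R : realType) (f : R -> 'rV[R]_2 -> 'rV[R]_2)
    (E : R -> 'rV[R]_2) (r0 omega : R) : Prop :=
  [/\ 0 < omega,
      \forall r \near r0, f r (E r) = 0,
      eigenvalue (cplx_jacobian (f r0) (E r0)) (0 +i* omega),
      eigenvalue (cplx_jacobian (f r0) (E r0)) (0 -i* omega) &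
      exists lambda : R -> R[i],
        [/\ lambda r0 = 0 +i* omega,
            \forall r \near r0,
              eigenvalue (cplx_jacobian (f r) (E r)) (lambda r) /\
              {for r, continuous (lambda : R -> R[i]^o)},
            derivable (fun r => complex.Re (lambda r)) r0 1 &
            derive1 (fun r => complex.Re (lambda r)) r0 != 0]].

(* The real vector u has complex coordinate z with respect to q and its
   conjugate. *)
Definition has_coord (R : realType) (q : 'rV[R[i]]_2) (u : 'rV[R]_2)
    (z : R[i]) : Prop :=
  cplx_mx u = z *: q + conjc z *: map_mx (@conjc R) q.

(* Terms of total degree n, 2 <= n < N, of the double series
   sum_(j, k) g j k / (j! k!) z^j (conjc z)^k. *)
Definition nonlinear_part (R : realType) (g : nat -> nat -> R[i]) (z : R[i])
    (N : nat) : R[i] :=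
  \sum_(2 <= n < N) \sum_(j < n.+1)
    g j (n - j)%N / (j`! * (n - j)`!)%:R * z ^+ j * conjc z ^+ (n - j).

(* In the coordinate z of x - x0, the system x' = f x takes the form
   z' = i omega z + sum_(j + k >= 2) g j k / (j! k!) z^j (conjc z)^k near z = 0;
   [Z z] is the value of z'. The series is summed by increasing total degree;
   R[i]^o carries the usual topology of the complex numbers. *)
Definition complex_form (R : realType) (f : 'rV[R]_2 -> 'rV[R]_2)
    (x0 : 'rV[R]_2) (omega : R) (q : 'rV[R[i]]_2) (g : nat -> nat -> R[i]) :
    Prop :=
  exists Z : R[i] -> R[i],
    (forall (u : 'rV[R]_2) (z : R[i]),
       has_coord q u z -> has_coord q (f (x0 + u)) (Z z)) /\
    \forall z \near (0 : R[i]^o),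
      (fun N => (0 +i* omega) * z + nonlinear_part g z N : R[i]^o) @ \oo
        --> (Z z : R[i]^o).

Definition lyapunov1 (R : realType) (omega : R) (g : nat -> nat -> R[i]) : R :=
  (2 * omega ^+ 2)^-1 *
  complex.Re ((0 +i* 1) * g 2%N 0%N * g 1%N 1%N + omega%:C * g 2%N 1%N).

(* The coefficients g are determined by q. *)
Definition positive_lyapunov1 (R : realType) (f : 'rV[R]_2 -> 'rV[R]_2)
    (x0 : 'rV[R]_2) (omega : R) : Prop :=
  forall q : 'rV[R[i]]_2, q != 0 ->
    q *m cplx_jacobian f x0 = (0 +i* omega) *: q ->
    exists g : nat -> nat -> R[i],
      complex_form f x0 omega q g /\ 0 < lyapunov1 omega g.

Definition subcritical_hopf (R : realType) (f : R -> 'rV[R]_2 -> 'rV[R]_2)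
    (E : R -> 'rV[R]_2) (r0 : R) : Prop :=
  exists omega : R,
    hopf_point f E r0 omega /\ positive_lyapunov1 (f r0) (E r0) omega.

Definition planar_system (R : realType) (p s r : R) (v : 'rV[R]_2) :
    'rV[R]_2 :=
  let x := v 0 0 in
  let y := v 0 1 in
  vec2 (- x - y) (p * x + r * y - s * y ^+ 2 - y ^+ 3).

Definition x2star (R : realType) (p s r : R) : R :=
  2^-1 * (s - Num.sqrt (s ^+ 2 + 4 * (r - p))).

Definition P2 (R : realType) (p s r : R) : 'rV[R]_2 :=
  vec2 (x2star p s r) (- x2star p s r).

(* Main.v *)
Require Import Defs.
From HB Require Import structures.
From mathcomp Require Import all_boot all_order all_algebra.
From mathcomp Require Import complex ring lra.
From mathcomp Require Import all_classical all_reals all_analysis.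
Import Order.TTheory GRing.Theory Num.Theory.
Import numFieldNormedType.Exports.
Local Open Scope ring_scope.

(** At an equilibrium (x, -x) the linearization has the matrix
    ((-1, -1), (p, a)) with a = r + 2 s x - 3 x^2, hence trace a - 1 and
    determinant p - a. A Hopf point is a solution of a = 1, and then
    omega^2 = p - 1. On the branch x = x2star, put
    S = sqrt (s^2 + 4 (r - p)) and D = sqrt (s^2 + 8 (p - 1)). The critical
    value of r is exactly the one for which S = (s + D) / 2, whence
    x = (s - D) / 4 and a = 1.

    Transversality: near the critical value the eigenvalue is
    (a - 1) / 2 + i sqrt (p - a - ((a - 1) / 2)^2) ([planar_eig]), and
    da/dr = s / S - 2 ([is_derive_jac_yy]), which is nonzero because
    2 S = s + D > s ([hopf_point_P2]).

    First Lyapunov coefficient: in coordinates (xi, eta) centred at the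
    equilibrium, the only nonlinear terms are - c eta^2 - eta^3 in the second
    equation, with c = s - 3 x. If q = (q0, q1) is an eigenvector for
    w = i omega, then q1 = - (1 + w) q0, and the linear form that is 1 on q and 0
    on its conjugate has second coordinate - 1 / (2 w q0). The equation for z
    is therefore the polynomial equation
      z' = w z + (c eta^2 + eta^3) / (2 w q0),
      eta = q1 z + conjc q1 conjc z,
    from which the g j k can be read off ([complex_form_planar]). As
    q1 / (2 w q0) = - 1/2 + i / (2 omega), one gets
      Re (i g20 g11 + omega g21) = |q1|^2 (2 c^2 - 3 omega^2) / omega
    ([lyapunov1_gt0]). At the critical value c = (s + 3 D) / 4, so that
    2 c^2 >= 9 D^2 / 8 >= 9 (p - 1) > 3 omega^2. *)

(** * Preliminaries from analysis *)

Lemma is_derive_coord (R : realType) (n : nat) (u v : 'rV[R]_n.+1) j :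
  is_derive u v (fun w : 'rV[R]_n.+1 => w 0 j) (v 0 j).
Proof.
have du : derivable (id : 'rV[R]_n.+1 -> _) u v by apply: ex_derive.
apply: DeriveDef; first by move/derivable_mxP: du; apply.
by have /matrixP/(_ 0 j) := derive_mx du; rewrite derive_id mxE => <-.
Qed.

Lemma near_ge0 (R : realType) (f : R -> R) (r : R) :
  {for r, continuous f} -> 0 < f r -> \forall t \near r, 0 <= f t.
Proof.
move=> fc f0; near=> t; apply: ltW; near: t.
exact: (cvgr_gt (f r)).
Unshelve. all: by end_near. Qed.

Local Open Scope complex_scope.

(** The norm of R[i] takes its values in R[i] itself, so the radius of a ball is
    a complex number; being positive, it is a real one. *)
Lemma continuous_complex (R : realType) (f g : R -> R) (x : R) :
  {for x, continuous f} -> {for x, continuous g} ->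
  {for x, continuous ((fun t => f t +i* g t) : R -> R[i]^o)}.
Proof.
move=> fx gx; apply/cvgrPdist_lt => e e0.
have [e1 eE] : 0 < complex.Re e /\ e = (complex.Re e)%:C.
  by move: e0; case: e => a b; rewrite ltcE /= => /andP[/eqP -> ->].
have e2 : 0 < complex.Re e / 2 by rewrite divr_gt0.
near=> t.
have h1 : `|f x - f t| < complex.Re e / 2.
  by near: t; move/cvgrPdist_lt: fx; apply.
have h2 : `|g x - g t| < complex.Re e / 2.
  by near: t; move/cvgrPdist_lt: gx; apply.
have nr (a : R) : `|a%:C| = (`|a|)%:C :> R[i].
  by rewrite normc_def /= expr0n /= addr0 sqrtr_sqr.
have ni : `|'i| = 1 :> R[i].
  by rewrite normc_def /= expr0n /= add0r expr1n sqrtr1.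
rewrite [X in `|X|]complexE /= (le_lt_trans (ler_normD _ _)) //.
rewrite normrM ni mul1r !nr -rmorphD eE ltcR.
by rewrite (splitr (complex.Re e)) ltrD.
Unshelve. all: by end_near. Qed.

(** * The linearization and its eigenvalues *)

(** The transpose of the matrix ((-1, -1), (p, a)), since Jacobians act on row
    vectors. *)
Definition planar_jac (K : nzRingType) (p a : K) : 'M[K]_2 :=
  \matrix_(i < 2, j < 2) if j == 0 then -1 else if i == 0 then p else a.

Lemma jacobian_planar (R : realType) (p s r : R) (u : 'rV[R]_2) :
  jacobian (planar_system p s r) u =
  planar_jac R p (r - 2 * s * u 0 1 - 3 * u 0 1 ^+ 2).
Proof.
pose X (w : 'rV[R]_2) : R := w 0 0; pose Y (w : 'rV[R]_2) : R := w 0 1.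
pose F := (- X - Y) : 'rV[R]_2 -> R.
pose G := (p *: X + r *: Y - s *: Y ^+ 2 - Y ^+ 3) : 'rV[R]_2 -> R.
have fE : planar_system p s r =
    (fun w => F w *: delta_mx 0 0) + (fun w => G w *: delta_mx 0 1).
  apply/funext => w; apply/rowP => j.
  rewrite !fctE !mxE /F /G !fctE /= /X /Y.
  by case: j => -[|[|//]] j /=; rewrite !(mulr1, mulr0, addr0, add0r).
have dX j : differentiable (fun w : 'rV[R]_2 => w 0 j) u.
  exact: differentiable_coord.
have dF : differentiable F u.
  by apply: differentiableB; [apply: differentiableN|]; exact: dX.
have dG : differentiable G u.
  by do !(apply: differentiableB || apply: differentiableD ||
          apply: differentiableZ || apply: differentiableX || apply: dX).
have df : differentiable (planar_system p s r) u.
  by rewrite fE; apply: differentiableD; apply: differentiableZl.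
have idX v : is_derive u v X (v 0 0) := is_derive_coord _ _ u v 0.
have idY v : is_derive u v Y (v 0 1) := is_derive_coord _ _ u v 1.
have DF v : is_derive u v F (- v 0 0 - v 0 1) by exact: is_deriveB.
have DG v : is_derive u v G
    (p * v 0 0 + (r - 2 * s * u 0 1 - 3 * u 0 1 ^+ 2) * v 0 1).
  by apply: is_derive_eq; rewrite /Y /GRing.scale /=; ring.
apply/row_matrixP => i; rewrite rowE -deriveEjacobian //.
rewrite derive_mx; last exact: diff_derivable.
apply/rowP => j; rewrite !mxE.
case: j => -[|[|//]] j /=.
- rewrite (_ : (fun _ => _) = F); last by apply/funext => w; rewrite !mxE.
  by rewrite derive_val !mxE; case: i => -[|[|//]] i /=; ring.
- rewrite (_ : (fun _ => _) = G); last by apply/funext => w; rewrite !mxE.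
  by rewrite derive_val !mxE; case: i => -[|[|//]] i /=; ring.
Qed.

Lemma cplx_planar_jac (R : realType) (p a : R) :
  cplx_mx (planar_jac R p a) = planar_jac R[i] p%:C a%:C.
Proof.
apply/matrixP => i j; rewrite !mxE.
by case: ifP => _; [rewrite rmorphN rmorph1 | case: ifP].
Qed.

Lemma eigenvalue_planar (K : fieldType) (p a l : K) :
  l ^+ 2 - (a - 1) * l + (p - a) = 0 -> eigenvalue (planar_jac K p a) l.
Proof.
move=> char; apply/eigenvalueP; exists (vec2 (-1) (1 + l)).
- apply/rowP => j; rewrite !mxE !big_ord_recl big_ord0 !mxE /= addr0.
  case: j => -[|[|//]] j /=; first by ring.
  by apply/eqP; rewrite -subr_eq0 -oppr_eq0 -char; apply/eqP; ring.
- apply/eqP => /matrixP/(_ 0 0); rewrite !mxE /= => /eqP.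
  by rewrite oppr_eq0 oner_eq0.
Qed.

(** The root with nonnegative imaginary part of the characteristic polynomial,
    when its roots are not real and distinct. *)
Definition planar_eig (R : realType) (p a : R) : R[i] :=
  ((a - 1) / 2) +i* Num.sqrt (p - a - ((a - 1) / 2) ^+ 2).

Lemma eigenvalue_planar_eig (R : realType) (p a : R) :
  0 <= p - a - ((a - 1) / 2) ^+ 2 ->
  eigenvalue (planar_jac R[i] p%:C a%:C) (planar_eig R p a).
Proof.
move=> disc; apply: eigenvalue_planar; rewrite /planar_eig.
set t := Num.sqrt _.
have -> : p = t ^+ 2 + ((a - 1) / 2) ^+ 2 + a by rewrite sqr_sqrtr //; ring.
apply/eqP; rewrite eq_complex expr2; apply/andP.
by split; apply/eqP => /=; field.
Qed.

(** * The branch of equilibria *)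

(** The only entry of the linearization at [P2 p s r] that depends on r. *)
Definition jac_yy (R : realType) (p s r : R) : R :=
  r + 2 * s * x2star p s r - 3 * x2star p s r ^+ 2.

Lemma jacobian_P2 (R : realType) (p s r : R) :
  cplx_jacobian (planar_system p s r) (P2 p s r) =
  planar_jac R[i] p%:C (jac_yy R p s r)%:C.
Proof.
rewrite /cplx_jacobian jacobian_planar cplx_planar_jac.
by congr (planar_jac _ _ _%:C); rewrite /jac_yy !mxE /=; ring.
Qed.

Lemma x2star_root (R : realType) (p s r : R) :
  0 <= s ^+ 2 + 4 * (r - p) ->
  x2star p s r * (p - r - s * x2star p s r + x2star p s r ^+ 2) = 0.
Proof.
move=> disc; rewrite /x2star; set t := Num.sqrt _.
have t2 : t ^+ 2 = s ^+ 2 + 4 * (r - p) by rewrite sqr_sqrtr.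
have -> : r = (t ^+ 2 - s ^+ 2) / 4 + p by rewrite t2; field.
by field.
Qed.

Lemma equilibrium_P2 (R : realType) (p s r : R) :
  0 <= s ^+ 2 + 4 * (r - p) -> planar_system p s r (P2 p s r) = 0.
Proof.
move=> disc; apply/rowP => j; rewrite !mxE /=.
case: ifP => _; first by ring.
by rewrite -[RHS](x2star_root _ p s r disc); ring.
Qed.

(** With S the square root, x2star = (s - S) / 2 has derivative - 1 / S, and
    1 - 2 s / S + 6 x2star / S = s / S - 2. *)
Lemma is_derive_jac_yy (R : realType) (p s r : R) :
  0 < s ^+ 2 + 4 * (r - p) ->
  is_derive r 1 (jac_yy R p s) (s / Num.sqrt (s ^+ 2 + 4 * (r - p)) - 2).
Proof.
move=> disc.
pose d : R -> R := cst (s ^+ 2) + 4 *: (id - cst p).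
have dd : is_derive r (1 : R) d 4.
  have := is_deriveD (is_derive_cst (s ^+ 2) r 1)
    (is_deriveZ 4 (is_deriveB (is_derive_id r 1) (is_derive_cst p r 1))).
  by rewrite add0r subr0 [_ *: _]mulr1.
have dr0 : 0 < d r by [].
have dS : is_derive r (1 : R) (Num.sqrt \o d) ((2 * Num.sqrt (d r))^-1 * 4).
  by apply: is_derive1_comp; exact: is_derive1_sqrt.
have S0 : Num.sqrt (d r) != 0 by rewrite sqrtr_eq0 -ltNge.
pose x := 2^-1 *: (cst s - (Num.sqrt \o d)).
have dx : is_derive r (1 : R) x (- (Num.sqrt (d r))^-1).
  by apply: is_derive_eq; rewrite sub0r /GRing.scale /=; field.
have -> : jac_yy R p s = id + (2 * s) *: x - 3 *: x ^+ 2 by apply/funext.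
have idr := is_derive_id r (1 : R).
apply: (is_derive_eq (is_deriveB (is_deriveD idr (is_deriveZ (2 * s) dx))
  (is_deriveZ 3 (is_deriveX 2 dx)))).
rewrite /x !fctE /GRing.scale /= -[s ^+ 2 + _ ]/(d r).
by field.
Qed.

Lemma continuous_jac_yy (R : realType) (p s : R) : continuous (jac_yy R p s).
Proof.
move=> t; rewrite /jac_yy.
have xc : {for t, continuous (x2star p s)}.
  apply: cvgMl_tmp; apply: cvgB; first exact: cvg_cst.
  apply: continuous_comp; last exact: sqrt_continuous.
  apply: cvgD; first exact: cvg_cst.
  by apply: cvgMl_tmp; apply: cvgB; [exact: cvg_id|exact: cvg_cst].
apply: cvgB; first by apply: cvgD; [exact: cvg_id|apply: cvgMl_tmp].
by apply: cvgMl_tmp; apply: (@cvgM _ _ _ _ _ _ _ _ xc xc).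
Qed.

(** The last hypothesis says that the derivative s / S - 2 of [jac_yy] is not
    zero, S being the square root. *)
Lemma hopf_point_P2 (R : realType) (p s r : R) :
  1 < p -> 0 < s ^+ 2 + 4 * (r - p) -> jac_yy R p s r = 1 ->
  s != 2 * Num.sqrt (s ^+ 2 + 4 * (r - p)) ->
  hopf_point (planar_system p s) (P2 p s) r (Num.sqrt (p - 1)).
Proof.
move=> p1 disc a1 trans.
have da := is_derive_jac_yy _ _ _ _ disc.
have ac := continuous_jac_yy R p s.
pose h t := (jac_yy R p s t - 1) / 2.
have hc : continuous h.
  by move=> t; apply: cvgMr_tmp; apply: cvgB; [exact: ac|exact: cvg_cst].
pose im2 t := p - jac_yy R p s t - h t ^+ 2.
have im2c : continuous im2.
  move=> t; apply: cvgB; first by apply: cvgB; [exact: cvg_cst|exact: ac].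
  exact: (cvgM (hc t) (hc t)).
have im2r : 0 < im2 r.
  by rewrite /im2 /h a1 subrr mul0r expr0n subr0 subr_gt0.
have eigr : planar_eig R p 1 = 0 +i* Num.sqrt (p - 1).
  by rewrite /planar_eig subrr mul0r expr0n subr0.
split.
- by rewrite sqrtr_gt0 subr_gt0.
- near=> t; apply: equilibrium_P2; near: t.
  apply: (@near_ge0 R (fun t => s ^+ 2 + 4 * (t - p))) => //.
  apply: cvgD; first exact: cvg_cst.
  by apply: cvgMl_tmp; apply: cvgB; [exact: cvg_id|exact: cvg_cst].
- rewrite jacobian_P2 -eigr a1; apply: eigenvalue_planar_eig.
  by rewrite subrr mul0r expr0n subr0 subr_ge0 ltW.
- rewrite jacobian_P2 a1; apply: eigenvalue_planar.
  set w := Num.sqrt _; have -> : p = w ^+ 2 + 1.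
    by rewrite sqr_sqrtr ?subrK // subr_ge0 ltW.
  apply/eqP; rewrite eq_complex expr2; apply/andP.
  by split; apply/eqP => /=; ring.
have ReE : (fun t => complex.Re (planar_eig R p (jac_yy R p s t))) =
    2^-1 *: (jac_yy R p s - cst 1).
  by apply/funext => t; rewrite /planar_eig /= mulrC.
exists (fun t => planar_eig R p (jac_yy R p s t)); split.
- by rewrite a1.
- near=> t; split.
    rewrite jacobian_P2; apply: eigenvalue_planar_eig; near: t.
    exact: (near_ge0 _ _ _ (im2c r) im2r).
  apply: (continuous_complex _ h (fun u => Num.sqrt (im2 u))).
    exact: hc.
  by apply: continuous_comp; [exact: im2c|exact: sqrt_continuous].
- by rewrite ReE; exact: ex_derive.
- rewrite ReE derive1E derive_val subr0 mulf_neq0 ?invr_eq0 ?pnatr_eq0 //.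
  rewrite subr_eq0; apply: contra trans => /eqP <-.
  by rewrite divfK // sqrtr_eq0 -ltNge.
Unshelve. all: by end_near. Qed.

(** * The complex form and the first Lyapunov coefficient *)

(** The coefficients g j k of (c eta^2 + eta^3) / (2 w q0) for
    eta = q1 z + conjc q1 conjc z: the power eta^n contributes
    n! q1^j (conjc q1)^k to g j k when j + k = n. *)
Definition planar_coef (R : realType) (c : R) (w q0 q1 : R[i]) (j k : nat) :
    R[i] :=
  (if (j + k == 2)%N then 2 * c%:C else if (j + k == 3)%N then 6 else 0) *
  (q1 ^+ j * conjc q1 ^+ k) / (2 * w * q0).

Lemma nonlinear_part_planar (R : realType) (c : R) (w q0 q1 z : R[i])
    (N : nat) :
  (4 <= N)%N ->
  nonlinear_part (planar_coef R c w q0 q1) z N =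
  (c%:C * (z * q1 + conjc z * conjc q1) ^+ 2 +
   (z * q1 + conjc z * conjc q1) ^+ 3) / (2 * w * q0).
Proof.
move=> N4; rewrite /nonlinear_part (big_cat_nat (n := 4)) //= addrC.
rewrite big1_seq ?add0r; last first.
  move=> n; rewrite mem_index_iota /= => /andP[n4 _]; apply: big1 => j _.
  rewrite /planar_coef subnKC; last by rewrite -ltnS.
  by case: n n4 j => [|[|[|[|n]]]] //= _ j; rewrite !mul0r.
rewrite big_ltn; last by [].
rewrite big_ltn; last by [].
rewrite big_geq; last by [].
rewrite addr0 !big_ord_recl !big_ord0 /bump.
rewrite !(addn0, add0n, addn1, subn0, lift0) /planar_coef.
have sb : [/\ 2 - 1 = 1, 2 - 2 = 0, 3 - 1 = 2, 3 - 2 = 1 & 3 - 3 = 0]%N by [].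
have fc : [/\ 0`! = 1, 1`! = 1, 2`! = 2 & 3`! = 6]%N by [].
case: sb fc => -> -> -> -> -> [-> -> -> ->]; rewrite !(mul1n, muln1) /=.
(* an identity between polynomials in independent variables *)
move: (conjc q1) (conjc z) c%:C (2 * w * q0)^-1 => q1' z' c' k.
by field.
Qed.

(** Projecting the nonlinear term (0, - c eta^2 - eta^3) along q, and parallel to
    the conjugate of q, multiplies its second coordinate by - 1 / (2 w q0); the
    series then reduces to a polynomial. *)
Lemma complex_form_planar (R : realType) (p s r x omega : R)
    (q : 'rV[R[i]]_2) :
  let c := s - 3 * x in
  omega != 0 -> omega ^+ 2 = p - 1 ->
  x * (p - r - s * x + x ^+ 2) = 0 ->
  r + 2 * s * x - 3 * x ^+ 2 = 1 ->
  q 0 0 != 0 -> q 0 1 = - (1 + (0 +i* omega)) * q 0 0 ->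
  complex_form (planar_system p s r) (vec2 x (- x)) omega q
    (planar_coef R c (0 +i* omega) (q 0 0) (q 0 1)).
Proof.
move=> c omega0 omega2 eqx trx.
rewrite /complex_form; move wE : (0 +i* omega) => w.
set a := q 0 0; set b := q 0 1 => a0 bE.
have w0 : w != 0 by rewrite -wE eq_complex /= eqxx.
have wJ : conjc w = - w.
  by apply/eqP; rewrite -wE eq_complex /= oppr0 !eqxx.
have w2 : w ^+ 2 = (1 - p)%:C.
  by rewrite -wE expr2; simpc; congr (_ +i* _); rewrite -expr2 omega2; ring.
pose a' := conjc a; pose b' := conjc b.
have a'0 : a' != 0 by rewrite conjc_eq0.
have b'E : b' = - (1 - w) * a'.
  by rewrite /b' bE rmorphM rmorphN rmorphD rmorph1 /= wJ.
pose eta z : R[i] := z * b + conjc z * b'.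
exists (fun z => w * z + (c%:C * eta z ^+ 2 + eta z ^+ 3) / (2 * w * a)).
split; last first.
  near=> z; apply: cvg_near_cst; near=> N.
  by rewrite nonlinear_part_planar //; near: N; exists 4%N.
move=> u z uz.
have u0 : (u 0 0)%:C = z * a + conjc z * a'.
  by have /matrixP/(_ 0 0) := uz; rewrite !mxE.
have u1 : (u 0 1)%:C = eta z.
  by have /matrixP/(_ 0 1) := uz; rewrite !mxE.
have etaJ : conjc (eta z) = eta z by rewrite -u1 conjc_real.
have ZJ : conjc (w * z + (c%:C * eta z ^+ 2 + eta z ^+ 3) / (2 * w * a)) =
   - w * conjc z - (c%:C * eta z ^+ 2 + eta z ^+ 3) / (2 * w * a').
  have n2 : (2 : R[i]) != 0 by rewrite pnatr_eq0.
  (* abstracting the real constants keeps their conjugates from unfolding *)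
  move: c%:C (conjc_real c) 2 n2 (conjc_nat R 2) => C CJ d d0 dJ.
  rewrite rmorphD /= !rmorphM /= rmorphD /= rmorphM /= !rmorphXn /= etaJ CJ.
  rewrite fmorphV /= !rmorphM /= wJ dJ -/a'.
  by field; rewrite w0 d0 a'0.
rewrite /has_coord ZJ; apply/rowP => j; rewrite !mxE.
have field_x : - (x + u 0 0) - (- x + u 0 1) = - u 0 0 - u 0 1 by ring.
have field_y : p * (x + u 0 0) + r * (- x + u 0 1) - s * (- x + u 0 1) ^+ 2 -
   (- x + u 0 1) ^+ 3 = p * u 0 0 + u 0 1 - c * u 0 1 ^+ 2 - u 0 1 ^+ 3.
  apply: subr0_eq; have -> : 0 = x * (p - r - s * x + x ^+ 2) +
      (r + 2 * s * x - 3 * x ^+ 2 - 1) * u 0 1.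
    by rewrite eqx trx subrr mul0r addr0.
  by rewrite /c; ring.
case: j => -[|[|//]] j /=.
- rewrite field_x rmorphB rmorphN /= u0 u1.
  rewrite (_ : q _ _ = a); last by congr (q _ _); exact: val_inj.
  rewrite -/a' /eta b'E bE.
  by field; rewrite w0 a0 a'0.
- rewrite field_y !(rmorphB, rmorphD, rmorphM, rmorphXn) /= u0 u1.
  rewrite (_ : q _ _ = b); last by congr (q _ _); exact: val_inj.
  have pE : p%:C = 1 - w ^+ 2 by rewrite w2 rmorphB rmorph1; ring.
  (* only the linear occurrence of eta z is expanded: the nonlinear ones are
     matched as they stand *)
  rewrite -/b' pE; set e := eta z.
  rewrite {1}(_ : e = z * b + conjc z * b') // b'E bE.
  by field; rewrite w0 a0 a'0.
Unshelve. all: by end_near. Qed.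

(** With k = q1 / (2 w q0) = - 1/2 + i / (2 omega) and n = |q1|^2, the quantity
    i g20 g11 + omega g21 equals 4 c^2 n i k^2 + 6 omega n k, whose real part is
    n (2 c^2 / omega - 3 omega). *)
Lemma lyapunov1_gt0 (R : realType) (c omega : R) (q0 q1 : R[i]) :
  0 < omega -> 3 * omega ^+ 2 < 2 * c ^+ 2 ->
  q0 != 0 -> q1 = - (1 + (0 +i* omega)) * q0 ->
  0 < lyapunov1 omega (planar_coef R c (0 +i* omega) q0 q1).
Proof.
move=> om0 cond q00 q1E.
set w := 0 +i* omega in q1E *.
have omN0 : omega != 0 by rewrite gt_eqF.
have w0 : w != 0 by rewrite eq_complex /= eqxx.
have q1N0 : q1 != 0.
  rewrite q1E mulf_neq0 // oppr_eq0 eq_complex /= !addr0 add0r.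
  by rewrite negb_and oner_eq0.
pose n : R := (complex.Re q1) ^+ 2 + (complex.Im q1) ^+ 2.
have nE : q1 * conjc q1 = n%:C.
  by rewrite /n; case: (q1) => x y; simpc; rewrite -!expr2; congr (_ +i* _); ring.
have n0 : 0 < n.
  have n_ge0 : 0 <= n by rewrite addr_ge0 ?sqr_ge0.
  rewrite lt_neqAle n_ge0 andbT eq_sym; apply/eqP => nz.
  by have /eqP := nE; rewrite nz mulf_eq0 conjc_eq0 orbb (negPf q1N0).
have kE : q1 / (2 * w * q0) = (- 2^-1) +i* (2 * omega)^-1.
  rewrite q1E (_ : _ / _ = - (1 + w) / (2 * w)); last first.
    by field; rewrite w0 q00.
  apply: (canLR (mulfK _)); first by rewrite mulf_neq0 ?pnatr_eq0.
  rewrite /w; apply/eqP; rewrite eq_complex /=; apply/andP.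
  by split; apply/eqP; field.
rewrite /lyapunov1 mulr_gt0 //; first by rewrite invr_gt0 mulr_gt0 ?exprn_gt0.
rewrite /planar_coef /=.
set I := 0 +i* 1; set k := q1 / (2 * w * q0).
rewrite (_ : _ + _ =
    (4 * c ^+ 2 * n)%:C * (I * k ^+ 2) + (6 * omega * n)%:C * k); last first.
  have -> : (4 * c ^+ 2 * n)%:C = 4 * c%:C ^+ 2 * (q1 * conjc q1).
    by rewrite nE 2!rmorphM rmorphXn rmorph_nat.
  have -> : (6 * omega * n)%:C = 6 * omega%:C * (q1 * conjc q1).
    by rewrite nE !rmorphM rmorph_nat.
  move: c%:C omega%:C => C om; rewrite /k.
  by rewrite expr0 !expr1 mulr1; field; rewrite w0 q00.
rewrite /k kE.
set X := complex.Re _.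
have -> : X = n * ((2 * c ^+ 2 - 3 * omega ^+ 2) / omega).
  by rewrite /X /=; field.
by rewrite mulr_gt0 // divr_gt0 // subr_gt0.
Qed.

Lemma positive_lyapunov1_planar (R : realType) (p s r x omega : R) :
  0 < omega -> omega ^+ 2 = p - 1 ->
  x * (p - r - s * x + x ^+ 2) = 0 ->
  r + 2 * s * x - 3 * x ^+ 2 = 1 ->
  3 * omega ^+ 2 < 2 * (s - 3 * x) ^+ 2 ->
  positive_lyapunov1 (planar_system p s r) (vec2 x (- x)) omega.
Proof.
move=> om0 om2 eqx trx cond q qN0.
rewrite /cplx_jacobian jacobian_planar cplx_planar_jac.
move=> /matrixP/(_ 0 0); rewrite !mxE !big_ord_recl big_ord0 !mxE /= addr0.
rewrite (_ : lift ord0 ord0 = 1); last exact: val_inj.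
move=> eig.
have q1E : q 0 1 = - (1 + (0 +i* omega)) * q 0 0.
  by rewrite mulNr mulrDl mul1r -eig; ring.
have q00 : q 0 0 != 0.
  apply: contra_neq qN0 => q00; apply/rowP => j; rewrite !mxE.
  case: j => -[|[|//]] j.
    by rewrite -[RHS]q00; congr (q _ _); exact: val_inj.
  rewrite -[RHS](mulr0 (- (1 + (0 +i* omega)))) -q00 -q1E.
  by congr (q _ _); exact: val_inj.
exists (planar_coef R (s - 3 * x) (0 +i* omega) (q 0 0) (q 0 1)); split.
  by apply: complex_form_planar => //; rewrite gt_eqF.
exact: lyapunov1_gt0.
Qed.

(** * The critical parameter value *)

Theorem proposition8 (R : realType) (p r s : R)
  (hp : 0 < p) (hr : 0 < r) (hs : 0 <= s) (hp1 : 1 < p)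
  (hcrit : r = 8^-1 * (- 4 + 12 * p - s ^+ 2
                       + s * Num.sqrt (- 8 + 8 * p + s ^+ 2))) :
  subcritical_hopf (planar_system p s) (P2 p s) r.
Proof.
set D := Num.sqrt (- 8 + 8 * p + s ^+ 2) in hcrit.
have s2 : 0 <= s ^+ 2 by exact: sqr_ge0.
have D2 : D ^+ 2 = - 8 + 8 * p + s ^+ 2 by rewrite sqr_sqrtr //; lra.
have D0 : 0 < D by rewrite sqrtr_gt0; lra.
have pE : p = (D ^+ 2 - s ^+ 2) / 8 + 1 by rewrite D2; field.
have discE : s ^+ 2 + 4 * (r - p) = ((s + D) / 2) ^+ 2.
  by rewrite hcrit pE; field.
have sqrtE : Num.sqrt (s ^+ 2 + 4 * (r - p)) = (s + D) / 2.
  by rewrite discE sqrtr_sqr ger0_norm //; lra.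
have xE : x2star p s r = (s - D) / 4 by rewrite /x2star sqrtE; field.
have a1 : jac_yy R p s r = 1 by rewrite /jac_yy xE hcrit pE; field.
have disc0 : 0 < s ^+ 2 + 4 * (r - p) by rewrite discE exprn_gt0 //; lra.
exists (Num.sqrt (p - 1)); split.
  apply: hopf_point_P2 => //; rewrite sqrtE; apply/eqP; lra.
have om2 : Num.sqrt (p - 1) ^+ 2 = p - 1 by rewrite sqr_sqrtr //; lra.
apply: positive_lyapunov1_planar => //.
- by rewrite sqrtr_gt0; lra.
- by apply: x2star_root; exact: ltW.
- have sD : 0 <= s * D by rewrite mulr_ge0 // ltW.
  have D20 : 0 < D ^+ 2 by rewrite exprn_gt0.
  (* as 8 (p - 1) = D^2 - s^2 and s - 3 x = (s + 3 D) / 4, the two sides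
     differ by (2 s^2 + 3 s D + 3 D^2) / 4 *)
  rewrite om2 xE; nra.
Qed.
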